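(* There is a reflection (an adjunction whose right adjoint is fully faithful) $K\dashv\mathbf{Loc}(-,\{0,1\})$ with left adjoint $K\colon\mathbf{PBoolean}\to\mathbf{Stone}^{\mathrm{op}}$ and right adjoint $\mathbf{Loc}(-,\{0,1\})\colon\mathbf{Stone}^{\mathrm{op}}\to\mathbf{PBoolean}$, in which the functor $K$ is determined by $K(A)=\lim_{C\in\mathcal{C}(A)^{\mathrm{op}}}\Sigma(C)$, the limit being taken in $\mathbf{Stone}$.
   Context: A partial Boolean algebra is a set $A$ with a reflexive and symmetric relation $\odot\subseteq A\times A$ (commeasurability), elements $0,1\in A$, a total unary operation $\lnot\colon A\to A$, and partial binary operations $\land,\lor\colon\odot\to A$, such that every set $S\subseteq A$ of pairwise commeasurable elements is contained in a set $T\subseteq A$ whose elements are also pairwise commeasurable and on which $0,1,\lnot,\land,\lor$ determine a Boolean algebra structure. A morphism is a function that preserves commeasurability and all the algebraic structure whenever defined. The resulting category is $\mathbf{PBoolean}$. Boolean algebras are the partial Boolean algebras with total commeasurability; they form the full subcategory $\mathbf{Boolean}$. A total subalgebra of $A$ is a subset of pairwise commeasurable elements containing $0,1$ and closed under $\lnot,\land,\lor$ (a Boolean algebra); $\mathcal{C}(A)$ is the poset of total subalgebras ordered by inclusion, regarded as a diagram of Boolean algebras and inclusions. $\mathbf{Stone}$ is the category of Stone spaces and continuous functions. $\Sigma\colon\mathbf{Boolean}\to\mathbf{Stone}^{\mathrm{op}}$ sends a Boolean algebra to its Stone spectrum, and $\mathbf{Loc}(-,\{0,1\})$ sends a Stone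 space $X$ to the Boolean algebra of continuous maps from $X$ to the discrete two-point space $\{0,1\}$ (equivalently, locale maps; equivalently, clopen subsets), regarded as a partial Boolean algebra; these two functors form the Stone duality equivalence $\mathbf{Boolean}\simeq\mathbf{Stone}^{\mathrm{op}}$. *)

(* Defs.v *)
From HB Require Import structures.
From mathcomp Require Import all_boot all_order.
From mathcomp Require Import mathcomp_extra boolp classical_sets functions.
From mathcomp Require Import filter topology.

Set Implicit Arguments.
Unset Strict Implicit.
Unset Printing Implicit Defensive.

Import Order.Theory.
Local Open Scope classical_set_scope.

Record category := Category {
  Ob :> Type;
  Hom : Ob -> Ob -> Type;
  idm : forall x, Hom x x;
  comp : forall x y z, Hom y z -> Hom x y -> Hom x z;
  comp1m : forall x y (f : Hom x y), comp (idm y) f = f;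
  compm1 : forall x y (f : Hom x y), comp f (idm x) = f;
  compA : forall w x y z (h : Hom y z) (g : Hom x y) (f : Hom w x),
    comp h (comp g f) = comp (comp h g) f }.

Arguments Hom {_} _ _.
Arguments idm {_} _.
Arguments comp {_ _ _ _} _ _.
Notation "g \oc f" := (comp g f) (at level 50, left associativity).
Notation "g \oc[ C ] f" := (@comp C _ _ _ g f)
  (at level 50, C at level 200, left associativity, only parsing).

Definition op (C : category) : category :=
  @Category C (fun x y => @Hom C y x) (@idm C) (fun x y z g f => comp f g)
    (fun x y f => compm1 f) (fun x y f => comp1m f)
    (fun w x y z h g f => esym (compA f g h)).

Definition full_subcategory (C : category) (P : C -> Prop) : category :=
  @Category {x : C | P x} (fun x y => Hom (sval x) (sval y))
    (fun x => idm (sval x)) (fun x y z g f => comp g f)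
    (fun x y f => comp1m f) (fun x y f => compm1 f)
    (fun w x y z h g f => compA h g f).

Record functor (C D : category) := Functor {
  fobj :> C -> D;
  fmap : forall x y, Hom x y -> Hom (fobj x) (fobj y);
  fmap1 : forall x, fmap (idm x) = idm (fobj x);
  fmapM : forall x y z (g : Hom y z) (f : Hom x y),
    fmap (g \oc f) = fmap g \oc fmap f }.

Arguments fmap {C D} _ {x y} _.

Section FunctorConstructions.
Context {C D E : category}.

Definition functor_comp (G : functor D E) (F : functor C D) : functor C E.
Proof.
refine (@Functor C E (fun x => G (F x)) (fun x y f => fmap G (fmap F f)) _ _).
- by move=> x; rewrite !fmap1.
- by move=> x y z g f; rewrite !fmapM.
Defined.

Definition functor_op (F : functor C (op D)) : functor (op C) D :=
  @Functor (op C) D F (fun x y f => @fmap _ _ F y x f) (@fmap1 _ _ F)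
    (fun x y z g f => @fmapM _ _ F z y x f g).

End FunctorConstructions.

Definition fully_faithful (C D : category) (F : functor C D) : Prop :=
  forall x y : C, bijective (@fmap C D F x y).

Record adjunction (C D : category) (F : functor C D) (G : functor D C) :=
  Adjunction {
    transpose : forall (c : C) (d : D), Hom (F c) d -> Hom c (G d);
    transpose_bij : forall c d, bijective (@transpose c d);
    transpose_nat : forall c c' d d'
      (h : Hom c' c) (f : Hom (F c) d) (k : Hom d d'),
      transpose (k \oc f \oc fmap F h) = fmap G k \oc transpose f \oc h }.

Definition is_reflection (C D : category)
    (F : functor C D) (G : functor D C) : Prop :=
  inhabited (adjunction F G) /\ fully_faithful G.

Record cone (J C : category) (D : functor J C) (L : C) := Cone {
  leg :> forall j : J, Hom L (D j);
  leg_nat : forall (i j : J) (u : Hom i j), fmap D u \oc leg i = leg j }.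

Definition is_limit (J C : category) (D : functor J C) (L : C)
    (p : cone D L) : Prop :=
  forall (X : C) (q : cone D X),
    exists! u : Hom X L, forall j, p j \oc u = q j.

(* The partial operations take a proof of commeasurability as an argument. *)
Record pba_sig := PbaSig {
  pba_car :> Type;
  comm : pba_car -> pba_car -> Prop;
  pzero : pba_car;
  pone : pba_car;
  pneg : pba_car -> pba_car;
  pmeet : forall x y, comm x y -> pba_car;
  pjoin : forall x y, comm x y -> pba_car }.

Arguments pzero {_}.
Arguments pone {_}.
Arguments pneg {_} _.
Arguments pmeet {_ x y} _.
Arguments pjoin {_ x y} _.

Definition pairwise_comm (A : pba_sig) (S : set A) : Prop :=
  forall x y, S x -> S y -> comm x y.

(* The operations of [A] restrict to a Boolean algebra structure on [T]: the
   inclusion of [T] is, up to renaming of elements, a map [i] from a Boolean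
   algebra [B] which carries the operations of [B] to those of [A]. *)
Definition boolean_on (A : pba_sig) (T : set A) : Prop :=
  exists (d : Order.disp_t) (B : ctbDistrLatticeType d) (i : B -> A),
    [/\ injective i /\ range i = T,
        i \bot%O = pzero /\ i \top%O = pone,
        forall a, i (~` a)%O = pneg (i a) &
        forall a b, exists c : comm (i a) (i b),
          i (a `&` b)%O = pmeet c /\ i (a `|` b)%O = pjoin c].

Record pba := Pba {
  pba_struct :> pba_sig;
  comm_refl : forall x : pba_struct, comm x x;
  comm_sym : forall x y : pba_struct, comm x y -> comm y x;
  comm_ext : forall S : set pba_struct, pairwise_comm S ->
    exists T : set pba_struct,
      [/\ S `<=` T, pairwise_comm T & boolean_on T] }.

Record pba_hom (A B : pba) := PbaHom {
  pba_fun :> A -> B;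
  hom_comm : forall x y, comm x y -> comm (pba_fun x) (pba_fun y);
  hom0 : pba_fun pzero = pzero;
  hom1 : pba_fun pone = pone;
  homN : forall x, pba_fun (pneg x) = pneg (pba_fun x);
  homI : forall x y (c : comm x y), pba_fun (pmeet c) = pmeet (hom_comm c);
  homU : forall x y (c : comm x y), pba_fun (pjoin c) = pjoin (hom_comm c) }.

Lemma pba_homP (A B : pba) (f g : pba_hom A B) : f =1 g -> f = g.
Proof.
case: f g => [f c z o n m j] [g c' z' o' n' m' j'] /= /funext e; subst g.
by have ec := Prop_irrelevance c c'; subst c'; congr PbaHom; apply: Prop_irrelevance.
Qed.

Definition pba_id (A : pba) : pba_hom A A.
Proof. by exists idfun (fun x y c => c). Defined.

Definition pba_comp (A B C : pba) (g : pba_hom B C) (f : pba_hom A B) :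
  pba_hom A C.
Proof.
exists (g \o f) (fun x y c => hom_comm g (hom_comm f c)) => /=.
- by rewrite !hom0.
- by rewrite !hom1.
- by move=> x; rewrite !homN.
- by move=> x y c; rewrite !homI.
- by move=> x y c; rewrite !homU.
Defined.

Definition PBoolean : category.
Proof.
refine (@Category pba pba_hom pba_id pba_comp _ _ _) => *; exact: pba_homP.
Defined.

Definition Boolean : category :=
  full_subcategory (fun A : PBoolean => forall x y : pba_car A, comm x y).

Definition total_pba_sig d (B : ctbDistrLatticeType d) : pba_sig :=
  @PbaSig B (fun _ _ => True) \bot%O \top%O (@Order.compl d B)
    (fun x y _ => (x `&` y)%O) (fun x y _ => (x `|` y)%O).

Definition total_pba d (B : ctbDistrLatticeType d) : pba.
Proof.
refine (@Pba (total_pba_sig B) (fun=> I) (fun _ _ _ => I) _) => S _.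
exists setT; split => //; exists d, B, idfun; split => //.
- by split => //; rewrite image_id.
- by move=> a b; exists I.
Defined.

Record total_subalgebra (A : pba) := TotalSubalgebra {
  sub_set :> A -> Prop;
  sub_comm : pairwise_comm sub_set;
  sub0 : sub_set pzero;
  sub1 : sub_set pone;
  subN : forall x, sub_set x -> sub_set (pneg x);
  subI : forall x y (c : comm x y),
    sub_set x -> sub_set y -> sub_set (pmeet c);
  subU : forall x y (c : comm x y),
    sub_set x -> sub_set y -> sub_set (pjoin c) }.

Definition subalgebra_poset (A : pba) : category.
Proof.
refine (@Category (total_subalgebra A) (fun C D => sub_set C `<=` sub_set D)
  (fun C => @subset_refl _ (sub_set C)) (fun C D E g f => subset_trans f g) _ _ _) => *;
  exact: Prop_irrelevance.
Defined.

Section TotalSubalgebraTheory.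
Context {A : pba} (C : total_subalgebra A).

Definition sub_sig : pba_sig :=
  @PbaSig {x : A | C x} (fun x y => comm (sval x) (sval y))
    (exist _ _ (sub0 C)) (exist _ _ (sub1 C))
    (fun x => exist _ _ (subN (proj2_sig x)))
    (fun x y c => exist _ _ (subI c (proj2_sig x) (proj2_sig y)))
    (fun x y c => exist _ _ (subU c (proj2_sig x) (proj2_sig y))).

Let U : Type := sub_sig.
Let val (x : U) : A := sval x.
Let cm (x y : U) : comm (val x) (val y) := sub_comm (proj2_sig x) (proj2_sig y).
Let I (x y : U) : U := @pmeet sub_sig x y (cm x y).
Let J (x y : U) : U := @pjoin sub_sig x y (cm x y).
Let N (x : U) : U := @pneg sub_sig x.
Let O : U := @pzero sub_sig.
Let T : U := @pone sub_sig.

Let sub_model : exists (d : Order.disp_t) (B : ctbDistrLatticeType d)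
  (r : U -> B), [/\ injective r,
    r O = \bot%O /\ r T = \top%O,
    forall x, r (N x) = (~` r x)%O &
    forall x y, r (I x y) = (r x `&` r y)%O /\ r (J x y) = (r x `|` r y)%O].
Proof.
have [D [CD _ [d [B [i [[injI rI] [i0 i1] iN iIU]]]]]] := comm_ext (@sub_comm _ C).
have E (x : U) : exists b : B, i b = val x.
  have := CD _ (proj2_sig x); rewrite -rI => -[b _ eb]; by exists b.
pose r x := projT1 (cid (E x)).
have rE x : i (r x) = val x by exact: (projT2 (cid (E x))).
have iIE a b x y (ca : comm x y) : i a = x -> i b = y ->
    i (a `&` b)%O = pmeet ca /\ i (a `|` b)%O = pjoin ca.
  move=> ea eb; subst x y; have [c [-> ->]] := iIU a b.
  by rewrite (Prop_irrelevance c ca).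
exists d, B, r; split.
- move=> x y /(congr1 i); rewrite !rE => e.
  case: x y e => [x px] [y py] /= e; subst y.
  by rewrite (Prop_irrelevance px py).
- by split; apply: injI; rewrite rE ?i0 ?i1.
- by move=> x; apply: injI; rewrite iN !rE.
- move=> x y; have [eI eU] := iIE _ _ _ _ (cm x y) (rE x) (rE y).
  by split; apply: injI; rewrite rE ?eI ?eU.
Qed.

Let IC : commutative I.
Proof.
by have [d [B [r [ir _ _ rm]]]] := sub_model; move=> x y; apply: ir; rewrite !(proj1 (rm _ _)) meetC.
Qed.
Let JC : commutative J.
Proof.
by have [d [B [r [ir _ _ rm]]]] := sub_model; move=> x y; apply: ir; rewrite !(proj2 (rm _ _)) joinC.
Qed.
Let IA : associative I.
Proof.
by have [d [B [r [ir _ _ rm]]]] := sub_model; move=> x y z; apply: ir; rewrite !(proj1 (rm _ _)) meetA.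
Qed.
Let JA : associative J.
Proof.
by have [d [B [r [ir _ _ rm]]]] := sub_model; move=> x y z; apply: ir; rewrite !(proj2 (rm _ _)) joinA.
Qed.
Let JKI y x : I x (J x y) = x.
Proof.
by have [d [B [r [ir _ _ rm]]]] := sub_model; apply: ir; rewrite (proj1 (rm _ _)) (proj2 (rm _ _)) joinKI.
Qed.
Let IKU y x : J x (I x y) = x.
Proof.
by have [d [B [r [ir _ _ rm]]]] := sub_model; apply: ir; rewrite (proj2 (rm _ _)) (proj1 (rm _ _)) meetKU.
Qed.
Let IUl : left_distributive I J.
Proof.
have [d [B [r [ir _ _ rm]]]] := sub_model; move=> x y z; apply: ir.
by rewrite (proj1 (rm _ _)) !(proj2 (rm _ _)) !(proj1 (rm _ _)) meetUl.
Qed.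
Let Ixx : idempotent_op I.
Proof.
by have [d [B [r [ir _ _ rm]]]] := sub_model; move=> x; apply: ir; rewrite (proj1 (rm _ _)) meetxx.
Qed.
Let I0x x : I O x = O.
Proof.
by have [d [B [r [ir [r0 _] _ rm]]]] := sub_model; apply: ir; rewrite (proj1 (rm _ _)) r0 meet0x.
Qed.
Let IxT x : I x T = x.
Proof.
by have [d [B [r [ir [_ r1] _ rm]]]] := sub_model; apply: ir; rewrite (proj1 (rm _ _)) r1 meetx1.
Qed.
Let JxN x : J x (N x) = T.
Proof.
by have [d [B [r [ir [_ r1] rN rm]]]] := sub_model; apply: ir; rewrite (proj2 (rm _ _)) rN r1 joinxC.
Qed.
Let IxN x : I x (N x) = O.
Proof.
by have [d [B [r [ir [r0 _] rN rm]]]] := sub_model; apply: ir; rewrite (proj1 (rm _ _)) rN r0 meetxC.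
Qed.

Definition sub_lattice : Type := U.
HB.instance Definition _ := gen_eqMixin sub_lattice.
HB.instance Definition _ := gen_choiceMixin sub_lattice.
Let le (x y : sub_lattice) : bool := (I x y : sub_lattice) == x.
Let lt (x y : sub_lattice) : bool := (y != x) && le x y.
HB.instance Definition _ := @Order.isMeetJoinDistrLattice.Build
  Order.default_display sub_lattice le lt I J (fun _ _ => erefl)
  (fun _ _ => erefl) IC JC IA JA JKI IKU IUl Ixx.
Let leOx x : le O x. Proof. exact/eqP/I0x. Qed.
Let lexT x : le x T. Proof. exact/eqP/IxT. Qed.
HB.instance Definition _ :=
  @Order.hasBottom.Build Order.default_display sub_lattice O leOx.
HB.instance Definition _ :=
  @Order.hasTop.Build Order.default_display sub_lattice T lexT.
HB.instance Definition _ := @Order.TBDistrLattice_hasComplement.Build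
  Order.default_display sub_lattice N JxN IxN.

Lemma sub_boolean : boolean_on [set: sub_sig].
Proof.
exists Order.default_display, sub_lattice, idfun; split => //.
- by split => //; rewrite image_id.
- by move=> a b; exists (cm a b).
Qed.

Lemma sub_total (x y : sub_sig) : comm x y.
Proof. exact: cm. Qed.

End TotalSubalgebraTheory.

Definition sub_pba (A : pba) (C : total_subalgebra A) : pba :=
  @Pba (sub_sig C) (fun x => sub_total x x) (fun x y _ => sub_total y x)
    (fun S _ => ex_intro _ setT (And3 (fun _ _ => I)
       (fun x y _ _ => sub_total x y) (sub_boolean C))).

Definition sub_boolean_algebra (A : pba) (C : total_subalgebra A) : Boolean :=
  exist _ (sub_pba C) (@sub_total A C).

Lemma sub_eq (A : pba) (C : total_subalgebra A) (x y : sub_pba C) :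
  sval x = sval y -> x = y.
Proof.
case: x y => [x px] [y py] /= e; subst y.
by rewrite (Prop_irrelevance px py).
Qed.

Definition sub_restrict (A B : PBoolean) (f : Hom A B)
    (C : total_subalgebra A) (D : total_subalgebra B)
    (fCD : forall x, C x -> D (f x)) :
  @Hom Boolean (sub_boolean_algebra C) (sub_boolean_algebra D).
Proof.
refine (@PbaHom (sub_pba C) (sub_pba D)
  (fun x => exist _ (f (sval x)) (fCD _ (proj2_sig x)))
  (fun x y c => hom_comm f c) _ _ _ _ _).
- exact/sub_eq/hom0.
- exact/sub_eq/hom1.
- by move=> x; apply/sub_eq/homN.
- by move=> x y c; apply/sub_eq/homI.
- by move=> x y c; apply/sub_eq/homU.
Defined.

Definition subalgebra_diagram (A : pba) :
  functor (subalgebra_poset A) Boolean.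
Proof.
refine (@Functor (subalgebra_poset A) Boolean (@sub_boolean_algebra A)
  (fun C D CD => @sub_restrict A A (@idm PBoolean A) C D CD) _ _).
- by move=> C; apply: pba_homP => x; apply: sub_eq.
- by move=> C D E g f; apply: pba_homP => x; apply: sub_eq.
Defined.

Record stone_space := StoneSpace {
  stone_top :> topologicalType;
  stone_compact : compact [set: stone_top];
  stone_hausdorff : hausdorff_space stone_top;
  stone_disconnected : totally_disconnected [set: stone_top] }.

Lemma cts_eq (X Y : topologicalType) (f g : continuousType X Y) :
  f =1 g -> f = g.
Proof. by move/continuousEP. Qed.

Definition Stone : category.
Proof.
refine (@Category stone_space (fun X Y => continuousType X Y)
  (fun X => (idfun : continuousType X X))
  (fun X Y Z g f => (g \o f : continuousType X Z)) _ _ _).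
- by move=> X Y f; apply: cts_eq.
- by move=> X Y f; apply: cts_eq.
- by move=> W X Y Z h g f; apply: cts_eq.
Defined.

Section LocTwo.
Context {X : topologicalType}.

Definition loc_two : Type := continuousType X bool.

Lemma loc_two_continuous2 (o : bool -> bool -> bool)
    (f g : continuousType X bool) : continuous (fun x => o (f x) (g x)).
Proof.
move=> x A /= /nbhs_singleton oA.
have fx := @cts_fun _ _ f x _ (discrete_set1 (f x)).
have gx := @cts_fun _ _ g x _ (discrete_set1 (g x)).
pose B := [set y | f y = f x /\ g y = g x].
have Bx : nbhs x B by exact: (@filterI _ (nbhs x) _ _ _ fx gx).
have BA : B `<=` (fun y => o (f y) (g y)) @^-1` A by move=> y [/= -> ->].
exact: filterS BA Bx.
Qed.

Definition loc_two_op (o : bool -> bool -> bool) (f g : loc_two) : loc_two :=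
  mkcts (@loc_two_continuous2 o f g).

Let O : loc_two := cst false : continuousType X bool.
Let T : loc_two := cst true : continuousType X bool.
Let I := loc_two_op andb.
Let J := loc_two_op orb.
Let N (f : loc_two) := loc_two_op (fun b _ => ~~ b) f f.

Let ext (f g : loc_two) : (forall x, f x = g x) -> f = g.
Proof. by move/continuousEP. Qed.

Let IC : commutative I. Proof. by move=> f g; apply: ext => x; apply: andbC. Qed.
Let JC : commutative J. Proof. by move=> f g; apply: ext => x; apply: orbC. Qed.
Let IA : associative I. Proof. by move=> f g h; apply: ext => x; apply: andbA. Qed.
Let JA : associative J. Proof. by move=> f g h; apply: ext => x; apply: orbA. Qed.
Let JKI g f : I f (J f g) = f.
Proof. by apply: ext => x; rewrite /= /mkcts; case: (f x). Qed.
Let IKU g f : J f (I f g) = f.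
Proof. by apply: ext => x; rewrite /= /mkcts; case: (f x). Qed.
Let IUl : left_distributive I J.
Proof. by move=> f g h; apply: ext => x; apply: andb_orl. Qed.
Let Ixx : idempotent_op I. Proof. by move=> f; apply: ext => x; apply: andbb. Qed.

HB.instance Definition _ := gen_eqMixin loc_two.
HB.instance Definition _ := gen_choiceMixin loc_two.
Let le (f g : loc_two) : bool := I f g == f.
Let lt (f g : loc_two) : bool := (g != f) && le f g.
HB.instance Definition _ := @Order.isMeetJoinDistrLattice.Build
  Order.default_display loc_two le lt I J (fun _ _ => erefl)
  (fun _ _ => erefl) IC JC IA JA JKI IKU IUl Ixx.
Let leOx f : le O f. Proof. by apply/eqP; apply: ext. Qed.
Let lexT f : le f T. Proof. by apply/eqP; apply: ext => x; apply: andbT. Qed.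
HB.instance Definition _ :=
  @Order.hasBottom.Build Order.default_display loc_two O leOx.
HB.instance Definition _ :=
  @Order.hasTop.Build Order.default_display loc_two T lexT.
Let JxN f : J f (N f) = T. Proof. by apply: ext => x; apply: orbN. Qed.
Let IxN f : I f (N f) = O. Proof. by apply: ext => x; apply: andbN. Qed.
HB.instance Definition _ := @Order.TBDistrLattice_hasComplement.Build
  Order.default_display loc_two N JxN IxN.

End LocTwo.

Arguments loc_two : clear implicits.

Definition loc_two_hom (X Y : topologicalType) (u : continuousType X Y) :
  pba_hom (total_pba (loc_two Y)) (total_pba (loc_two X)).
Proof.
refine (@PbaHom (total_pba (loc_two Y)) (total_pba (loc_two X))
  (fun f => (f \o u : continuousType X bool)) (fun _ _ _ => I) _ _ _ _ _);
  by move=> *; apply: cts_eq.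
Defined.

Definition LocTwo : functor (op Stone) PBoolean.
Proof.
refine (@Functor (op Stone) PBoolean
  (fun X : stone_space => total_pba (loc_two X))
  (fun X Y u => loc_two_hom u) _ _).
- by move=> X; apply: pba_homP => f; apply: cts_eq.
- by move=> X Y Z g f; apply: pba_homP => h; apply: cts_eq.
Defined.

Definition two : pba := total_pba bool.

HB.instance Definition _ (A B : pba) := gen_eqMixin (pba_hom A B).
HB.instance Definition _ (A B : pba) := gen_choiceMixin (pba_hom A B).

(* The points are the homomorphisms into {0,1} (equivalently, the ultrafilters);
   the topology is that of pointwise convergence, which is generated by the
   sets of points taking the value 1 at a given element. *)
Definition spectrum (A : pba) : topologicalType :=
  initial_topology (fun h : pba_hom A two => (h : {ptws A -> bool})).

Section SpectrumStone.
Context (A : pba).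

Lemma spectrum_eval_continuous (a : A) :
  continuous (fun h : spectrum A => (h : pba_hom A two) a : bool).
Proof.
move=> h.
apply: (@continuous_comp (spectrum A) {ptws {classic A} -> bool} bool
  (fun h : spectrum A => (h : pba_hom A two) : _ -> bool)
  (@proj {classic A} (fun=> bool) a)).
  exact: initial_continuous.
exact: (@proj_continuous {classic A} (fun=> bool)).
Qed.

Lemma spectrum_eval_nbhs (h : spectrum A) (a : A) :
  \forall g \near h, (g : pba_hom A two) a = (h : pba_hom A two) a.
Proof. exact: (spectrum_eval_continuous (discrete_set1 _)). Qed.

Lemma spectrum_zero_dimensional : zero_dimensional (spectrum A).
Proof.
move=> g h /eqP gh.
have [a gha] : exists a, (g : pba_hom A two) a <> (h : pba_hom A two) a.
  by apply: contrapT => /forallNP e; apply: gh; apply: pba_homP => a; apply: contrapT (e a).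
exists ((fun h : spectrum A => (h : pba_hom A two) a : bool)
  @^-1` [set (g : pba_hom A two) a]).
split => //=; last by move=> /esym.
apply: preimage_clopen; last exact: spectrum_eval_continuous.
by split; [exact: discrete_open | exact: discrete_closed].
Qed.

Lemma spectrum_hausdorff : hausdorff_space (spectrum A).
Proof.
rewrite open_hausdorff => g h /spectrum_zero_dimensional [U [[oU cU] Ug Uh]].
exists (U, ~` U); first by split; apply/mem_set.
by split => //=; [exact: closed_openC | rewrite setICr].
Qed.

Lemma spectrum_compact : compact [set: spectrum A].
Proof.
rewrite compact_ultra => F FU _.
pose v (a : A) : bool := `[< F [set h | (h : pba_hom A two) a] >].
have vE a : F [set h : spectrum A | (h : pba_hom A two) a = v a].
  rewrite /v; case: asboolP => // nF.
  have [//|] := in_ultra_setVsetC [set h : spectrum A | (h : pba_hom A two) a] FU.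
  by apply: filterS => h /= /negP/negbTE.
have pt (P : Prop) (S : set (spectrum A)) : F S -> (forall h, S h -> P) -> P.
  by move=> /filter_ex [h Sh] /(_ h Sh).
have v0 : v pzero = false.
  by apply: (pt _ _ (vE pzero)) => h /= <-; rewrite hom0.
have v1 : v pone = true.
  by apply: (pt _ _ (vE pone)) => h /= <-; rewrite hom1.
have vN a : v (pneg a) = ~~ v a.
  by apply: (pt _ _ (filterI (vE (pneg a)) (vE a))) => h /= [<- <-]; rewrite homN.
have vI a b (c : comm a b) : v (pmeet c) = v a && v b.
  apply: (pt _ _ (filterI (vE (pmeet c)) (filterI (vE a) (vE b)))) => h /=.
  by move=> [<- [<- <-]]; rewrite homI.
have vU a b (c : comm a b) : v (pjoin c) = v a || v b.
  apply: (pt _ _ (filterI (vE (pjoin c)) (filterI (vE a) (vE b)))) => h /=.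
  by move=> [<- [<- <-]]; rewrite homU.
pose h : pba_hom A two :=
  @PbaHom A two v (fun _ _ _ => Logic.I) v0 v1 vN vI vU.
exists (h : spectrum A); split => //.
pose e (g : spectrum A) : {ptws A -> bool} := g : pba_hom A two.
have ecvg : e @ F --> (v : {ptws A -> bool}).
  apply/cvg_sup => a U [V [[W oW <-] Wva] /filterS]; apply.
  have sW : [set g : spectrum A | (g : pba_hom A two) a = v a] `<=`
      [set g | W (e g a)] by move=> g /= ga; rewrite /e ga.
  exact: filterS sW (vE a).
move=> U [V [[W oW <-] Wh] VU]; apply: (filterS VU).
by apply: ecvg; apply: open_nbhs_nbhs; split.
Qed.

End SpectrumStone.

Definition stone_spectrum (A : pba) : stone_space :=
  StoneSpace (@spectrum_compact A) (@spectrum_hausdorff A)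
    (zero_dimension_totally_disconnected (@spectrum_zero_dimensional A)).

Section SpectrumMap.
Context (A B : pba) (f : pba_hom A B).

Definition spectrum_map_fun (h : spectrum B) : spectrum A :=
  pba_comp (h : pba_hom B two) f.

Lemma spectrum_map_continuous : continuous spectrum_map_fun.
Proof.
apply: continuous_comp_initial => h.
have FF := @fmap_filter _ _ ([eta pba_fun (B:=two)] \o spectrum_map_fun)
  _ (nbhs_filter h).
apply/cvg_sup => a U.
move=> [V [[W oW <-] Wha] /filterS]; apply.
have sW : [set g : spectrum B | (g : pba_hom B two) (f a) =
    (h : pba_hom B two) (f a)] `<=` [set g | W ((g : pba_hom B two) (f a))].
  by move=> g /= ga; rewrite ga.
exact: (@filterS _ (nbhs h) _ _ _ sW (spectrum_eval_nbhs h (f a))).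
Qed.

Definition spectrum_map : continuousType (spectrum B) (spectrum A) :=
  mkcts spectrum_map_continuous.

End SpectrumMap.

Definition Spectrum : functor Boolean (op Stone).
Proof.
refine (@Functor Boolean (op Stone) (fun B => stone_spectrum (sval B))
  (fun A B f => spectrum_map f) _ _).
- by move=> A; apply: cts_eq => h; apply: pba_homP.
- by move=> A B C g f; apply: cts_eq => h; apply: pba_homP.
Defined.

Definition spectral_diagram (A : pba) :
    functor (op (subalgebra_poset A)) Stone :=
  functor_op (functor_comp Spectrum (subalgebra_diagram A)).

Definition spectral_map (A B : PBoolean) (f : Hom A B)
    (C : total_subalgebra A) (D : total_subalgebra B)
    (fCD : forall x, C x -> D (f x)) :
    @Hom Stone (spectral_diagram B D) (spectral_diagram A C) :=
  fmap Spectrum (sub_restrict fCD).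

(* Main.v *)
(** K(A) is the space of homomorphisms A -> 2 with the topology of pointwise
    convergence.  A compatible family of points of the spectra of the total
    subalgebras is the same thing as one homomorphism A -> 2, because any two
    commeasurable elements lie in a common total subalgebra; so K(A) is the
    limit.  The adjunction swaps the arguments of a map A * X -> 2 that is a
    homomorphism in A and continuous in X.  Full faithfulness of Loc(-, 2) is
    Stone duality: clopen sets separate the points of a compact totally
    disconnected Hausdorff space, and by compactness every homomorphism
    Loc(X, 2) -> 2 is evaluation at a point. *)

From mathcomp Require Import all_boot all_order.
From mathcomp Require Import boolp classical_sets functions filter topology.
Require Import Defs.

Set Implicit Arguments.
Unset Strict Implicit.
Unset Printing Implicit Defensive.

Local Open Scope classical_set_scope.

(** * Total subalgebras containing given elements *)

Lemma total_subalgebra_ext (A : pba) (S : set A) :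
  pairwise_comm S -> exists C : total_subalgebra A, S `<=` C.
Proof.
move=> /comm_ext[T [ST Tc [d [B [i [[_ rI] [i0 i1] iN iIU]]]]]].
have iE x : T x <-> exists b, i b = x.
  by rewrite -rI; split=> [[b _ <-]|[b <-]]; exists b.
have TI x y (c : comm x y) : T x -> T y -> T (pmeet c) /\ T (pjoin c).
  move=> /iE[a ea] /iE[b eb]; subst x y.
  have [c' [eI eU]] := iIU a b; rewrite (Prop_irrelevance c c').
  by split; apply/iE; [exists (a `&` b)%O | exists (a `|` b)%O].
have T0 : T pzero by apply/iE; exists \bot%O.
have T1 : T pone by apply/iE; exists \top%O.
have TN x : T x -> T (pneg x).
  by move=> /iE[b <-]; apply/iE; exists (~` b)%O.
by exists (TotalSubalgebra Tc T0 T1 TN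
  (fun x y c Tx Ty => proj1 (TI x y c Tx Ty))
  (fun x y c Tx Ty => proj2 (TI x y c Tx Ty))).
Qed.

Lemma total_subalgebra_comm (A : pba) (x y : A) :
  comm x y -> exists C : total_subalgebra A, C x /\ C y.
Proof.
move=> c; have [|C SC] := @total_subalgebra_ext A [set z | z = x \/ z = y].
  by move=> ? ? [] -> [] ->; do ?[exact: comm_refl | exact: comm_sym].
by exists C; split; apply: SC; [left | right].
Qed.

(** A common lower bound in the poset, through which values taken in two incomparable subalgebras
    can be compared. *)
Definition subalgebra_cap (A : pba) (C D : total_subalgebra A) :
  total_subalgebra A.
Proof.
refine (@TotalSubalgebra A (sub_set C `&` sub_set D) _ (conj _ _) (conj _ _)
  _ _ _).
- by move=> x y [Cx _] [Cy _]; apply: (@sub_comm _ C).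
- exact: sub0.
- exact: sub0.
- exact: sub1.
- exact: sub1.
- by move=> x [Cx Dx]; split; apply: subN.
- by move=> x y c [Cx Dx] [Cy Dy]; split; apply: subI.
- by move=> x y c [Cx Dx] [Cy Dy]; split; apply: subU.
Defined.

(** * The spectrum of a partial Boolean algebra as a limit *)

Lemma spectrum_continuous (X : topologicalType) (A : pba)
    (f : X -> spectrum A) :
  (forall a, continuous (fun x => (f x : pba_hom A two) a : bool)) ->
  continuous f.
Proof.
move=> fc; apply: continuous_comp_initial => x.
have FF := @filter.fmap_filter _ _ ([eta pba_fun (B:=two)] \o f) _ (nbhs_filter x).
apply/cvg_sup => a U [V [[W oW <-] Wxa] /filterS]; apply.
have sW : [set y | (f y : pba_hom A two) a = (f x : pba_hom A two) a] `<=`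
    [set y | W ((f y : pba_hom A two) a)].
  by move=> y /= ->.
exact: (@filterS _ (nbhs x) _ _ _ sW (fc a x _ (discrete_set1 _))).
Qed.

Definition spectrum_functor : functor PBoolean (op Stone).
Proof.
refine (@Functor PBoolean (op Stone) stone_spectrum
  (fun A B f => spectrum_map f) _ _).
- by move=> A; apply: cts_eq => h; apply: pba_homP.
- by move=> A B C g f; apply: cts_eq => h; apply: pba_homP.
Defined.

Definition sub_incl (A : pba) (C : total_subalgebra A) :
  pba_hom (sub_pba C) A.
Proof. by exists (fun x : sub_pba C => sval x) (fun x y c => c). Defined.

Definition spectrum_cone (A : PBoolean) : cone (spectral_diagram A) (spectrum_functor A).
Proof.
refine (@Cone _ Stone (spectral_diagram A) (spectrum_functor A)
  (fun C => spectrum_map (sub_incl C)) _).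
by move=> C D u; apply: cts_eq => h; apply: pba_homP.
Defined.

Section Gluing.
Context (A : pba) (X : stone_space).
Variable q : cone (spectral_diagram A) (X : Stone).

Let ev (C : total_subalgebra A) (x : X) (a : A) (Ca : C a) : bool :=
  ((q C : continuousType X (spectrum (sub_pba C))) x : pba_hom (sub_pba C) two)
    (exist _ a Ca).

(** The legs at [C] and at [D] both restrict to the leg at their intersection, which contains
    [a]. *)
Lemma cone_eval_agree (C D : total_subalgebra A) (x : X) (a : A)
  (Ca : C a) (Da : D a) : ev x Ca = ev x Da.
Proof.
pose E := subalgebra_cap C D.
have EC : sub_set E `<=` sub_set C by move=> z [].
have ED : sub_set E `<=` sub_set D by move=> z [].
suff evE (G : total_subalgebra A) (EG : sub_set E `<=` sub_set G)
    (Ga : G a) : ev x Ga = ev x (conj Ca Da : E a).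
  by rewrite (evE C EC) (evE D ED).
rewrite /ev -(leg_nat q (EG : @Hom (op (subalgebra_poset A)) G E)) /=.
congr (pba_fun (q G x : pba_hom (sub_pba G) two) _); exact: sub_eq.
Qed.

Lemma pick_subalgebra (a : A) : {C : total_subalgebra A | C a}.
Proof.
by apply: cid; have [C []] := total_subalgebra_comm (comm_refl a); exists C.
Qed.

Definition glue_val (x : X) (a : A) : bool :=
  ev x (projT2 (pick_subalgebra a)).

Lemma glue_valE x a (C : total_subalgebra A) (Ca : C a) :
  glue_val x a = ev x Ca.
Proof. exact: cone_eval_agree. Qed.

Definition glue_hom (x : X) : pba_hom A two.
Proof.
refine (@PbaHom A two (glue_val x) (fun _ _ _ => I) _ _ _ _ _).
(* Any total subalgebra contains both constants; the one picked for [pzero] serves here and for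
   [pone]. *)
- rewrite (glue_valE x (sub0 (projT1 (pick_subalgebra pzero)))).
  exact: (hom0 (q _ x : pba_hom (sub_pba _) two)).
- rewrite (glue_valE x (sub1 (projT1 (pick_subalgebra pzero)))).
  exact: (hom1 (q _ x : pba_hom (sub_pba _) two)).
- move=> a; have [C [Ca _]] := total_subalgebra_comm (comm_refl a).
  rewrite (glue_valE x Ca) (glue_valE x (subN Ca)).
  exact: (homN (q C x : pba_hom (sub_pba C) two) (exist _ a Ca)).
(* The picked subalgebras of [a], [b] and their meet may differ, so all three values are moved to
   one [C], where the leg gives a homomorphism. *)
- move=> a b c; have [C [Ca Cb]] := total_subalgebra_comm c.
  rewrite (glue_valE x (subI c Ca Cb)) /= (glue_valE x Ca) (glue_valE x Cb).
  exact: (@homI _ _ (q C x : pba_hom (sub_pba C) two)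
            (exist _ a Ca) (exist _ b Cb) c).
- move=> a b c; have [C [Ca Cb]] := total_subalgebra_comm c.
  rewrite (glue_valE x (subU c Ca Cb)) /= (glue_valE x Ca) (glue_valE x Cb).
  exact: (@homU _ _ (q C x : pba_hom (sub_pba C) two)
            (exist _ a Ca) (exist _ b Cb) c).
Defined.

(** The subalgebra picked for [a] does not vary with the point, so each coordinate is a single leg
    followed by an evaluation. *)
Lemma glue_continuous : continuous (glue_hom : X -> spectrum A).
Proof.
apply: spectrum_continuous => a x.
pose C := pick_subalgebra a.
exact: (continuous_comp (@cts_fun _ _
  (q (projT1 C) : continuousType X (spectrum (sub_pba (projT1 C)))) x)
  (@spectrum_eval_continuous _ (exist _ a (projT2 C) : sub_pba _) _)).
Qed.

End Gluing.

Lemma spectrum_cone_limit (A : PBoolean) : is_limit (spectrum_cone A).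
Proof.
move=> X q; exists (mkcts (@glue_continuous A X q) : continuousType X (spectrum A)); split.
  move=> C; apply: cts_eq => x; apply: pba_homP => -[a Ca].
  exact: (glue_valE q x Ca).
(* Uniqueness: each [a] lies in some [C], and the leg at [C] fixes the value at [a]. *)
move=> u uq; apply: cts_eq => x; apply: pba_homP => a.
have [C [Ca _]] := total_subalgebra_comm (comm_refl (a : pba_struct A)).
rewrite /= (glue_valE q x Ca).
by have -> : q C = spectrum_cone A C \oc[Stone] u by rewrite uq.
Qed.

(** * The adjunction, by swapping arguments *)

Section Transpose.
Context (A : pba) (X : stone_space).

Lemma eval_continuous (u : continuousType X (spectrum A)) (a : A) :
  continuous (fun x => (u x : pba_hom A two) a : bool).
Proof.
by move=> x; exact: (continuous_comp (@cts_fun _ _ u x)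
                       (@spectrum_eval_continuous _ a _)).
Qed.

Definition spectrum_transpose (u : continuousType X (spectrum A)) :
  pba_hom A (total_pba (loc_two X)).
Proof.
refine (@PbaHom A (total_pba (loc_two X))
  (fun a => mkcts (@eval_continuous u a) : continuousType X bool)
  (fun _ _ _ => I) _ _ _ _ _).
- by apply: cts_eq => x; exact: (hom0 (u x : pba_hom A two)).
- by apply: cts_eq => x; exact: (hom1 (u x : pba_hom A two)).
- by move=> a; apply: cts_eq => x; exact: (homN (u x : pba_hom A two)).
- by move=> a b c; apply: cts_eq => x; exact: (homI (u x : pba_hom A two)).
- by move=> a b c; apply: cts_eq => x; exact: (homU (u x : pba_hom A two)).
Defined.

Definition loc_two_eval (x : X) : pba_hom (total_pba (loc_two X)) two.
Proof.
by refine (@PbaHom (total_pba (loc_two X)) two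
  (fun f => (f : continuousType X bool) x) (fun _ _ _ => I) _ _ _ _ _).
Defined.

Lemma untranspose_continuous (h : pba_hom A (total_pba (loc_two X))) :
  continuous (fun x : X => pba_comp (loc_two_eval x) h : spectrum A).
Proof.
apply: spectrum_continuous => a x.
exact: (@cts_fun _ _ (h a : continuousType X bool) x).
Qed.

Definition spectrum_untranspose (h : pba_hom A (total_pba (loc_two X))) :
  continuousType X (spectrum A) := mkcts (@untranspose_continuous h).

End Transpose.

Definition spectrum_LocTwo_adjunction : adjunction spectrum_functor LocTwo.
Proof.
refine (@Adjunction PBoolean (op Stone) spectrum_functor LocTwo
  (fun A X => @spectrum_transpose A X) _ _).
- move=> A X; exists (@spectrum_untranspose A X).
  + by move=> u; apply: cts_eq => x; apply: pba_homP.
  + by move=> h; apply: pba_homP => a; apply: cts_eq.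
- by move=> A A' X X' h f k; apply: pba_homP => a; apply: cts_eq.
Defined.

(** * Quasicomponents of compact Hausdorff spaces *)

Section Quasicomponent.
Context (X : topologicalType).
Hypotheses (cX : compact [set: X]) (hX : hausdorff_space X).

Definition quasicomponent (x : X) : set X :=
  [set y | forall D : set X, clopen D -> D x -> D y].

Lemma quasicomponent_closed (x : X) : closed (quasicomponent x).
Proof.
move=> y cy D clD Dx; apply: (proj2 clD) => V Vy.
by have [z [Qz Vz]] := cy V Vy; exists z; split => //; exact: Qz.
Qed.

(** If every clopen set around [x] met [G], these intersections would generate a proper filter. A
    cluster point of it would lie in [G] and in every such clopen set, hence in the
    quasicomponent. *)
Lemma quasicomponent_avoid (x : X) (G : set X) :
  closed G -> quasicomponent x `&` G = set0 ->
  exists D : set X, [/\ clopen D, D x & D `&` G = set0].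
Proof.
move=> cG QG; apply: contrapT => noD.
pose F := filter_from [set D : set X | clopen D /\ D x] (fun D => D `&` G).
have FF : Filter F.
  apply: filter_from_filter; first by exists setT; split => //; exact: clopenT.
  move=> D E [clD Dx] [clE Ex]; exists (D `&` E).
    by split => //; exact: clopenI.
  by move=> y [[Dy Ey] Gy].
have PF : ProperFilter F.
  apply: filter_from_proper => D [clD Dx]; apply/set0P/eqP => DG0.
  by apply: noD; exists D.
have [y [_ cly]] := @cX F PF filterT.
suff : (quasicomponent x `&` G) y by rewrite QG.
split=> [D clD Dx|].
  apply: (proj2 clD) => V Vy; have [|z [[Dz _] Vz]] := cly (D `&` G) V _ Vy.
    by exists D.
  by exists z.
apply: cG => V Vy; have [|z [[_ Gz] Vz]] := cly ([set: X] `&` G) V _ Vy.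
  by exists setT => //; split => //; exact: clopenT.
by exists z.
Qed.

(* If a clopen [B] splits the quasicomponent [Q], normality yields an open [U]
   containing [B] whose closure misses [Q `\` B]; the boundary of [U] then misses
   [Q], hence misses some clopen [D] around [x], and [D `&` U] is clopen. *)
Lemma quasicomponent_connected (x : X) : connected (quasicomponent x).
Proof.
set Q := quasicomponent x => B [b Bb] [O oO BO] [C cC BC].
have Qc : closed Q by exact: quasicomponent_closed.
have Bc : closed B by rewrite BC; exact: closedI.
have RE : Q `\` B = Q `&` ~` O.
  by rewrite BO setDE setCI setIUr setICr set0U.
have Rc : closed (Q `\` B) by rewrite RE; apply: closedI => //; exact: open_closedC.
have [U [oU BU] UR] : exists2 U : set X, open U /\ B `<=` U &
    closure U `<=` ~` (Q `\` B).
  have : set_nbhs B (~` (Q `\` B)).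
    apply/set_nbhsP; exists (~` (Q `\` B)); split => //; first exact: closed_openC.
    by move=> y By [].
  move=> /(compact_normal hX cX Bc)[W /set_nbhsP[U [oU BU UW]] WR].
  by exists U => //; apply: subset_trans WR; exact: closureS.
have [D [clD Dx DG]] : exists D : set X,
    [/\ clopen D, D x & D `&` (closure U `&` ~` U) = set0].
  apply: quasicomponent_avoid.
    by apply: closedI; [exact: closed_closure | exact: open_closedC].
  apply/seteqP; split=> // y [Qy [clUy nUy]].
  by apply: (UR y clUy); split=> // By; apply/nUy/BU.
have DU : D `&` U = D `&` closure U.
  apply/seteqP; split=> y [Dy Uy]; split=> //; first exact: subset_closure.
  by apply: contrapT => nUy; rewrite -[False]/(set0 y) -DG.
have clDU : clopen (D `&` U).
  split; first by apply: openI => //; case: clD.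
  by rewrite DU; apply: closedI; [case: clD | exact: closed_closure].
have BQ : B `<=` Q by rewrite BO => y [].
apply/seteqP; split=> // y Qy; apply: contrapT => nBy.
(* The quasicomponent lies on the same side of the clopen set [D] meet [U] as [x]. If [x] is in [U],
   then so is [y], against [UR]; otherwise [b] is excluded from [U], against [BU]. *)
have [Ux|nUx] := pselect (U x).
  have [_ Uy] := Qy _ clDU (conj Dx Ux).
  by apply: (UR y); [exact: subset_closure | split].
have clDnU : clopen (~` (D `&` U)) by apply: clopenC.
have := BQ _ Bb _ clDnU (fun DUx => nUx (proj2 DUx)).
by apply; split; [exact: (BQ _ Bb) | exact: BU].
Qed.

End Quasicomponent.

(** Points that no clopen set separates share a quasicomponent; it is connected, hence a single
    point. *)
Lemma stone_zero_dimensional (X : stone_space) : zero_dimensional X.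
Proof.
move=> x y /eqP xy; apply: contrapT => nU; apply: xy.
have Qx : quasicomponent x x by [].
have Qy : quasicomponent x y.
  by move=> D clD Dx; apply: contrapT => nDy; apply: nU; exists D.
have := connected_component_max Qx (@subsetT _ _)
  (quasicomponent_connected (@stone_compact X) (@stone_hausdorff X) (x:=x)).
by rewrite (@stone_disconnected X x I) => /(_ y Qy).
Qed.

(** * Stone duality: full faithfulness *)

Section Indicator.
Context (X : topologicalType) (U : set X).
Hypothesis clU : clopen U.

Lemma indicator_continuous : continuous (fun x : X => `[< U x >]).
Proof.
move=> x V /= /nbhs_singleton Vx; case: clU => oU cU.
have [Ux|nUx] := pselect (U x).
  have : nbhs x U by apply: open_nbhs_nbhs.
  apply: filterS => y Uy /=.
  by move: Vx; rewrite (asboolT Ux) (asboolT Uy).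
have : nbhs x (~` U).
  by apply: open_nbhs_nbhs; split => //; exact: closed_openC.
apply: filterS => y Uy /=.
by move: Vx; rewrite (asboolF nUx) (asboolF Uy).
Qed.

Definition indicator : loc_two X :=
  mkcts indicator_continuous : continuousType X bool.

End Indicator.

Lemma loc_two_separated (X : stone_space) (x y : X) :
  (forall f : continuousType X bool, f x = f y) -> x = y.
Proof.
move=> fxy; apply: contrapT => /eqP /stone_zero_dimensional[U [clU Ux nUy]].
by move: (fxy (indicator clU)); rewrite /indicator /= /mkcts asboolT ?asboolF.
Qed.

Lemma loc_two_sober (X : stone_space) (h : pba_hom (total_pba (loc_two X)) two) :
  exists x : X, forall f : continuousType X bool, h (f : loc_two X) = f x.
Proof.
pose L := total_pba (loc_two X).
pose B := [set f : loc_two X | h (f : L)].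
pose V (f : loc_two X) := [set x | (f : continuousType X bool) x].
(* A cluster point of the filter generated by the clopen sets that [h] sends
   to 1 is the required point. *)
pose F := filter_from B V.
have FF : Filter F.
  apply: filter_from_filter; first by exists (pone : L); rewrite /B /= hom1.
  move=> f g hf hg; exists (@pmeet L f g I).
    by rewrite /B /= (@homI _ _ h f g I); apply/andP.
  by move=> x /andP.
have PF : ProperFilter F.
  apply: filter_from_proper => f hf; apply: contrapT => /forallNP nf.
  have f0 : f = (pzero : L).
    by apply: cts_eq => x /=; apply/negbTE/negP/nf.
  by move: hf; rewrite /B /= f0 hom0.
have [x [_ clx]] := @stone_compact X F PF filterT.
have hx (f : continuousType X bool) : h (f : L) -> f x.
  move=> hf; apply/negPn/negP => nfx.
  have FV : F (V f) by exists f.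
  have [y [fy]] := clx _ _ FV (@cts_fun _ _ f x _ (discrete_set1 _)).
  by move: fy nfx; rewrite /V /= => + nfx e; rewrite e; apply/negP.
(* The converse of [hx] is [hx] applied to the complement of [f]. *)
exists x => f; apply/idP/idP; first exact: hx.
apply: contraLR; rewrite -[~~ h _]/(@pneg two (h (f : L))) -homN.
by move/hx.
Qed.

(** The map [u phi] inducing [phi] sends [y] to the point that represents [phi] followed by
    evaluation at [y]. *)
Lemma LocTwo_fully_faithful : fully_faithful LocTwo.
Proof.
move=> X Y.
have uP (phi : pba_hom (total_pba (loc_two X)) (total_pba (loc_two Y))) y :=
  cid (loc_two_sober (pba_comp (loc_two_eval y) phi)).
pose u phi y := projT1 (uP phi y).
have uE phi (f : continuousType X bool) y :
    f (u phi y) = (phi (f : loc_two X) : continuousType Y bool) y.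
  by rewrite -(projT2 (uP phi y) f).
have uc phi : continuous (u phi).
  move=> y W Wy.
  (* Clopen neighbourhoods suffice, and the preimage of a clopen [D] is where [phi] of its indicator
     is true. *)
  have [D [Dy clD] DW] := zero_dimensional_cvg (@stone_hausdorff X)
    (@stone_zero_dimensional X) (@stone_compact X) Wy.
  have : nbhs y [set z | (phi (indicator clD) : continuousType Y bool) z =
                         (phi (indicator clD) : continuousType Y bool) y].
    exact: (@cts_fun _ _ (phi (indicator clD) : continuousType Y bool) y _
              (discrete_set1 _)).
  apply: filterS => z; rewrite /= -!uE /indicator /= /mkcts (asboolT Dy).
  by move=> /asboolP; exact: DW.
exists (fun phi => mkcts (uc phi) : continuousType Y X).
- move=> v; apply: cts_eq => y; apply: loc_two_separated => f.
  exact: (uE (loc_two_hom v) f y).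
- by move=> phi; apply: pba_homP => f; apply: cts_eq => y; exact: uE.
Qed.

Theorem proposition8 :
  exists (K : functor PBoolean (op Stone))
         (p : forall A : PBoolean, cone (spectral_diagram A) (K A)),
    [/\ is_reflection K LocTwo,
        forall A : PBoolean, is_limit (p A) &
        forall (A B : PBoolean) (f : Hom A B)
               (C : total_subalgebra A) (D : total_subalgebra B)
               (fCD : forall x, C x -> D (f x)),
          p A C \oc[Stone] fmap K f = spectral_map fCD \oc[Stone] p B D].
Proof.
exists spectrum_functor, spectrum_cone; split.
- split; last exact: LocTwo_fully_faithful.
  exact: (inhabits spectrum_LocTwo_adjunction).
- exact: spectrum_cone_limit.
(* Both composites send [h] to the restriction to [C] of [h] after [f]. *)
- by move=> A B f C D fCD; apply: cts_eq => h; apply: pba_homP.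
Qed.
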